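(* For every $\varepsilon\in(0,1/64)$ there exists a family of MHR distributions supported on $[1,2]$ such that, with either the one-sample hint or the value-range hint, any pricing-query algorithm that for every distribution in the family outputs a price $\widehat p$ with $\mathrm{Rev}(\widehat p)\ge(1-\varepsilon)\max_p\mathrm{Rev}(p)$ with probability at least $2/15$ must perform $\Omega(\varepsilon^{-2})$ pricing queries.
   Context: Pricing query model: the buyer's value has unknown CDF $F(p)=\Pr[v<p]$; the algorithm adaptively posts prices $p_1,\dots,p_m$; at each query a fresh independent $v_t\sim F$ is drawn and only $\mathbf 1\{v_t\ge p_t\}$ is observed; finally it outputs a price. $q(p)=1-F(p)$, $\mathrm{Rev}(p)=p\,q(p)$. One-sample hint: before any queries the algorithm observes one realized value $v_0\sim F$ (and nothing else about $F$). Value-range hint: the algorithm knows the support of $F$ lies in $[1,H]$ (here $H=2$). A distribution with density $f$ is MHR if $f(v)/(1-F(v))$ is nondecreasing on its support. *)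

(* Defs.v *)
From HB Require Import structures.
From mathcomp Require Import all_boot all_order all_algebra.
From mathcomp Require Import all_classical all_reals all_analysis.
Set Implicit Arguments. Unset Strict Implicit. Unset Printing Implicit Defensive.
Import Order.TTheory GRing.Theory Num.Theory.
Local Open Scope classical_set_scope.
Local Open Scope ring_scope.

Section PricingDefs.
Variable R : realType.
Implicit Types (f : R -> R) (p x y eps : R).

(* A value distribution is represented by its (Lebesgue) density f.
   q(p) = Pr[v >= p] = 1 - F(p) = int_{[p,+oo)} f. *)
Definition qval f p : R := Rintegral lebesgue_measure `[p, +oo[ f.

Definition Rev f p : R := p * qval f p.

Definition density_on_1_2 f : Prop :=
  [/\ measurable_fun setT f,
      (forall x, 0 <= f x),
      (forall x, x \notin `[1, 2] -> f x = 0)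
    & (\int[lebesgue_measure]_x (f x)%:E = 1)%E].

(* MHR: the hazard rate f(v)/(1-F(v)) is nondecreasing on the support,
   i.e. wherever 1 - F(v) > 0 (to the left of the support the hazard is 0). *)
Definition MHR f : Prop :=
  forall x y, x <= y -> 0 < qval f y -> f x / qval f x <= f y / qval f y.

Definition good_price f eps (phat : R) : Prop :=
  forall p, (1 - eps) * Rev f p <= Rev f phat.

Definition bitprob f p (b : bool) : R := if b then qval f p else 1 - qval f p.

(* Success probability of a deterministic adaptive m-query algorithm:
   the (t+1)-th posted price is  price (bits observed so far)  and the final
   output is  out (all m observed bits).  Sum over all bit outcomes. *)
Definition tree_success f eps (m : nat) (price out : seq bool -> R) : R :=
  \sum_(b : m.-tuple bool)
     (\prod_(i < m) bitprob f (price (take i b)) (tnth b i)) *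
     (if `[< good_price f eps (out b) >] then 1 else 0).

(* Randomized algorithm with internal randomness w ~ P and the one-sample hint
   v0 ~ f (independent): success probability. *)
Definition success_sample d (T : measurableType d) (P : probability T R)
  f eps (m : nat) (price out : T -> R -> seq bool -> R) : \bar R :=
  (\int[P]_w \int[lebesgue_measure]_v
      (f v * tree_success f eps m (price w v) (out w v))%:E)%E.

(* Randomized algorithm with internal randomness w ~ P and only the
   value-range hint (support in [1,2], which is built into the setting). *)
Definition success_range d (T : measurableType d) (P : probability T R)
  f eps (m : nat) (price out : T -> seq bool -> R) : \bar R :=
  (\int[P]_w (tree_success f eps m (price w) (out w))%:E)%E.

End PricingDefs.

(* Main.v *)
(* The hard family consists of 15 densities on [1, 2] equal to A on [1, x_i),
   to B >= A on [x_i, s) and to a high constant on [s, 2).  They are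
   nondecreasing, hence MHR, and their revenue curves have a kink at x_i, so
   that the sets of (1 - eps)-optimal prices are pairwise disjoint when the x_i
   are suitably spaced.

   A sampled value v0 hardly tells these densities apart: they all lie below an
   envelope of mass M = 1 + (B - A) (x_14 - x_0), so the sum of the 15 success
   probabilities is at most M times the largest sum attainable without sample.
   Without queries that sum is at most 1 by disjointness.  With m queries, a
   chi-square change of measure to a single reference density adds a small
   constant as long as m times the squared perturbation of q is small.  In both
   cases the total stays below 2 = 15 * (2/15).

   If eps < 1/144^2, take A = 2/3 and B - A = 4 w with kinks in a window of width
   w = 6 sqrt(eps) next to the revenue maximiser 5/4 of the uniform slope A: the
   perturbation of q is then O(w^2) = O(eps).  Otherwise only m = 0 needs to be
   excluded, and A = 0, B = 4/3 with kinks 5/4 + i/20 gives M = 29/15. *)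

Require Import Defs.
From HB Require Import structures.
From mathcomp Require Import all_boot all_order all_algebra.
From mathcomp Require Import all_classical all_reals all_analysis.
From mathcomp Require Import measurable_realfun ring lra.
Import Order.TTheory GRing.Theory Num.Theory.
Local Open Scope classical_set_scope.
Local Open Scope ring_scope.

Set Implicit Arguments. Unset Strict Implicit.

(** * Path weights on the binary tree of answers *)

Lemma big_tuple_cons (V : nmodType) (m : nat) (F : m.+1.-tuple bool -> V) :
  \sum_b F b = \sum_x \sum_(b : m.-tuple bool) F [tuple of x :: b].
Proof.
rewrite pair_big /=.
rewrite (reindex (fun p : bool * m.-tuple bool => [tuple of p.1 :: p.2])) //=.
exists (fun b => (thead b, [tuple of behead b])) => [[x b] _ | b _] /=.
  by congr (_, _); apply: val_inj.
by rewrite -tuple_eta.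
Qed.

Section TreeMass.
Variable R : realType.
Implicit Types (W : R -> bool -> R) (price : seq bool -> R).

Definition path_weight W price (m : nat) (b : m.-tuple bool) : R :=
  \prod_(i < m) W (price (take i b)) (tnth b i).

Lemma path_weight_cons W price m x (b : m.-tuple bool) :
  path_weight W price [tuple of x :: b] =
  W (price [::]) x * path_weight W (fun s => price (x :: s)) b.
Proof.
rewrite /path_weight big_ord_recl /= tnth0; congr (_ * _).
by apply: eq_bigr => i _; rewrite tnthS.
Qed.

Lemma path_weight_ge0 W price m (b : m.-tuple bool) :
  (forall p x, 0 <= W p x) -> 0 <= path_weight W price b.
Proof. by move=> W0; apply: prodr_ge0 => i _; exact: W0. Qed.

Lemma sum_path_weight W price m :
  (forall p, W p true + W p false = 1) ->
  \sum_(b : m.-tuple bool) path_weight W price b = 1.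
Proof.
move=> W1; elim: m price => [|m IHm] price.
  rewrite (big_pred1 [tuple]) => [|b]; first by rewrite /path_weight big_ord0.
  by apply/esym/eqP; exact: tuple0.
rewrite big_tuple_cons big_bool /=.
by under eq_bigr do rewrite path_weight_cons;
  under [X in _ + X]eq_bigr do rewrite path_weight_cons;
  rewrite -!mulr_sumr !IHm !mulr1.
Qed.

(** After the first bit a tree with its own prices remains, so per-query bounds multiply even for
    adaptive prices. Applied to [chi2_bit], this tensorises the chi-square divergence. *)
Lemma sum_path_weight_le W price m (v : R) :
  (forall p x, 0 <= W p x) -> (forall p, W p true + W p false <= v) ->
  \sum_(b : m.-tuple bool) path_weight W price b <= v ^+ m.
Proof.
move=> W0 Wv; have v0 : 0 <= v by apply: le_trans (Wv 0); rewrite addr_ge0.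
elim: m price => [|m IHm] price.
  rewrite (big_pred1 [tuple]) => [|b]; first by rewrite /path_weight big_ord0 expr0.
  by apply/esym/eqP; exact: tuple0.
rewrite big_tuple_cons big_bool /=.
under eq_bigr do rewrite path_weight_cons.
under [X in _ + X]eq_bigr do rewrite path_weight_cons.
rewrite -!mulr_sumr exprS.
apply: (@le_trans _ _ ((W (price [::]) true + W (price [::]) false) * v ^+ m)).
  by rewrite mulrDl lerD // ler_wpM2l.
by rewrite ler_wpM2r // exprn_ge0.
Qed.

End TreeMass.

(** * Change of measure to a reference density *)

Section TreeSuccess.
Variables (R : realType) (eps : R) (m : nat).
Implicit Types (f : R -> R) (V eta : R) (price out : seq bool -> R).

Lemma tree_successE f price out : tree_success f eps m price out =
  \sum_(b : m.-tuple bool) path_weight (bitprob f) price b *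
     (if `[< good_price f eps (out b) >] then 1 else 0).
Proof. by []. Qed.

Lemma bitprob_ge0 f p x : (forall p, 0 <= qval f p <= 1) -> 0 <= bitprob f p x.
Proof. by move=> /(_ p) /andP[q0 q1]; case: x => //=; rewrite subr_ge0. Qed.

Lemma bitprob_sum f p : bitprob f p true + bitprob f p false = 1.
Proof. by rewrite /= addrC subrK. Qed.

(* [chi2_bit] vanishes where the reference probability does, because of the
   convention x / 0 = 0; the numerator vanishes there as well. *)
Definition chi2_bit f0 f p x : R := bitprob f p x ^+ 2 / bitprob f0 p x.

(** For Bernoulli parameters q and r the chi-square sum is 1 + (q - r)^2 / (r (1 - r)). The
    hypothesis is multiplied out, so that at r = 0 or r = 1 it forces q = r. *)
Lemma sum_chi2_bit f0 f V p : 0 <= V -> 0 <= qval f0 p <= 1 ->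
  (qval f p - qval f0 p) ^+ 2 <= V * (qval f0 p * (1 - qval f0 p)) ->
  chi2_bit f0 f p true + chi2_bit f0 f p false <= 1 + V.
Proof.
rewrite /chi2_bit /bitprob; move: (qval f p) (qval f0 p) => q r V0 /andP[r0 r1] H.
have [re0|rn0] := eqVneq r 0.
  have q0 : q = 0.
    apply/eqP; rewrite -sqrf_eq0 eq_le sqr_ge0 andbT.
    by move: H; rewrite re0 subr0 mul0r mulr0.
  by rewrite re0 q0 invr0 mulr0 add0r subr0 expr1n divr1 lerDl.
have [re1|rn1] := eqVneq r 1.
  have q1 : q = 1.
    apply/eqP; rewrite -subr_eq0 -sqrf_eq0 eq_le sqr_ge0 andbT.
    by move: H; rewrite re1 subrr !mulr0.
  by rewrite re1 q1 subrr invr0 mulr0 addr0 expr1n divr1 lerDl.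
have rp : 0 < r by rewrite lt_neqAle eq_sym rn0.
have rl : 0 < 1 - r by rewrite subr_gt0 lt_neqAle rn1.
have -> : q ^+ 2 / r + (1 - q) ^+ 2 / (1 - r)
   = 1 + (q - r) ^+ 2 / (r * (1 - r)).
  by field; rewrite !gt_eqF.
by rewrite lerD2l ler_pdivrMr ?mulr_gt0.
Qed.

(** Absolute continuity: without it the convention x / 0 = 0 would hide mass of [f] on paths that
    are null for [f0]. *)
Lemma bitprob_dominated f0 f V p x : 0 <= V ->
  (qval f p - qval f0 p) ^+ 2 <= V * (qval f0 p * (1 - qval f0 p)) ->
  bitprob f0 p x = 0 -> bitprob f p x = 0.
Proof.
rewrite /bitprob; move: (qval f p) (qval f0 p) => q r V0 H.
case: x => /eqP.
  move=> /eqP re0; apply/eqP; rewrite -sqrf_eq0 eq_le sqr_ge0 andbT.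
  by move: H; rewrite re0 subr0 mul0r mulr0.
rewrite subr_eq0 => /eqP re1; apply/eqP.
rewrite -sqrf_eq0 eq_le sqr_ge0 andbT -[1 - q]opprB sqrrN.
by move: H; rewrite -re1 subrr !mulr0.
Qed.

(* Change of measure with a chi-square remainder:
   [P - P0 <= eta * P0 + (P - P0)^2 / (4 eta P0)] path by path. *)
Lemma change_of_measure f0 f price (A : pred (seq bool)) V eta :
  0 <= V -> 0 < eta ->
  (forall p, 0 <= qval f0 p <= 1) -> (forall p, 0 <= qval f p <= 1) ->
  (forall p, (qval f p - qval f0 p) ^+ 2 <= V * (qval f0 p * (1 - qval f0 p))) ->
  \sum_(b : m.-tuple bool)
     path_weight (bitprob f) price b * (if A b then 1 else 0)
  <= \sum_(b : m.-tuple bool)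
       path_weight (bitprob f0) price b * (if A b then 1 else 0)
     + eta + ((1 + V) ^+ m - 1) / (4 * eta).
Proof.
move=> V0 eta0 q0 q1 H.
have chi0 p x : 0 <= chi2_bit f0 f p x.
  by rewrite /chi2_bit divr_ge0 ?exprn_ge0 // bitprob_ge0.
have S2 := @sum_path_weight_le R (chi2_bit f0 f) price m (1 + V) chi0
  (fun p => sum_chi2_bit V0 (q0 p) (H p)).
have S0 := @sum_path_weight R (bitprob f0) price m (bitprob_sum f0).
have S1 := @sum_path_weight R (bitprob f) price m (bitprob_sum f).
have pathwise (b : m.-tuple bool) :
  path_weight (bitprob f) price b * (if A b then 1 else 0) <=
  path_weight (bitprob f0) price b * (if A b then 1 else 0)
  + eta * path_weight (bitprob f0) price b
  + (path_weight (chi2_bit f0 f) price b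
     - 2 * path_weight (bitprob f) price b
     + path_weight (bitprob f0) price b) / (4 * eta).
  have P00 := @path_weight_ge0 R (bitprob f0) price m b
    (fun p x => bitprob_ge0 p x q0).
  have : path_weight (chi2_bit f0 f) price b =
    path_weight (bitprob f) price b ^+ 2 / path_weight (bitprob f0) price b.
    rewrite /path_weight /chi2_bit prodf_div; congr (_ / _).
    by rewrite -prodrXl.
  have : path_weight (bitprob f0) price b = 0 -> path_weight (bitprob f) price b = 0.
    move=> /eqP /prodf_eq0[i _ /eqP /(bitprob_dominated V0 (H _)) pi0].
    by apply/eqP/prodf_eq0; exists i => //; apply/eqP.
  move: (path_weight (bitprob f0) price b) (path_weight (bitprob f) price b)
    (path_weight (chi2_bit f0 f) price b) P00.
  move=> r p c r0 pr ->.
  have [re0|rn0] := eqVneq r 0.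
    by rewrite pr // re0 !(mul0r, mulr0, expr0n, subr0, addr0).
  have rp : 0 < r by rewrite lt_neqAle eq_sym rn0.
  (* AM-GM: the expression is a perfect square over [eta * r]. *)
  have sq : 0 <= eta * r + (p ^+ 2 / r - 2 * p + r) / (4 * eta) - (p - r).
    have -> : eta * r + (p ^+ 2 / r - 2 * p + r) / (4 * eta) - (p - r) =
      ((p - r) / 2 - eta * r) ^+ 2 / (eta * r).
      by field; rewrite !gt_eqF.
    by rewrite divr_ge0 ?sqr_ge0 // ltW // mulr_gt0.
  (* Off the event only this remainder is left, so it has to be nonnegative. *)
  have sq' : 0 <= eta * r + (p ^+ 2 / r - 2 * p + r) / (4 * eta).
    have -> : p ^+ 2 / r - 2 * p + r = (p - r) ^+ 2 / r.
      by field; rewrite !gt_eqF.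
    apply: addr_ge0; first by rewrite mulr_ge0 // ltW.
    by rewrite !divr_ge0 ?sqr_ge0 // ltW // mulr_gt0.
  case: (A b); rewrite ?mulr1 ?mulr0; lra.
apply: (le_trans (ler_sum _ (fun b _ => pathwise b))).
rewrite !big_split /= -mulr_sumr -mulr_suml big_split big_split /=.
rewrite sumrN -mulr_sumr S0 S1 mulr1 lerD2l.
rewrite ler_pM2r ?invr_gt0 ?mulr_gt0 //.
lra.
Qed.

Lemma sum_exclusive_le1 (T : choiceType) k (G : 'I_k -> T -> Prop) (y : T) :
  (forall i j : 'I_k, (i < j)%N -> ~ (G i y /\ G j y)) ->
  \sum_(i < k) (if `[< G i y >] then 1 else 0 : R) <= 1.
Proof.
move=> excl; have [[i Gi]|none] := pselect (exists i, G i y).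
  rewrite (bigD1 i) //= (asboolT Gi) big1 ?addr0 // => j ji.
  rewrite asboolF // => Gj.
  case: (ltngtP i j) => [/excl|/excl|/val_inj ij]; [exact|by move=> /(_ (conj Gj Gi))|].
  by rewrite ij eqxx in ji.
by rewrite big1 // => i _; rewrite asboolF // => Gi; apply: none; exists i.
Qed.

(** All densities are compared with the same [f0], and each path has a single output, good for at
    most one [i]. The reference terms thus sum to at most 1, and each of the [k] comparisons adds
    one remainder. *)
Lemma tree_success_sum_le k (f : 'I_k -> R -> R) f0 price out V eta :
  0 <= V -> 0 < eta ->
  (forall p, 0 <= qval f0 p <= 1) -> (forall i p, 0 <= qval (f i) p <= 1) ->
  (forall i p, (qval (f i) p - qval f0 p) ^+ 2
     <= V * (qval f0 p * (1 - qval f0 p))) ->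
  (forall (i j : 'I_k) y, (i < j)%N ->
     ~ (good_price (f i) eps y /\ good_price (f j) eps y)) ->
  \sum_i tree_success (f i) eps m price out
   <= 1 + k%:R * (eta + ((1 + V) ^+ m - 1) / (4 * eta)).
Proof.
move=> V0 eta0 q0 qf H excl.
apply: le_trans.
  apply: ler_sum => i _; rewrite tree_successE.
  exact: (@change_of_measure f0 (f i) price
    (fun b => `[< good_price (f i) eps (out b) >]) V eta V0 eta0 q0 (qf i) (H i)).
under eq_bigr do rewrite -addrA.
rewrite big_split /= sumr_const card_ord -[X in _ + X]mulr_natl lerD2r.
rewrite exchange_big /=.
rewrite -[leRHS](@sum_path_weight R (bitprob f0) price m (bitprob_sum f0)).
apply: ler_sum => b _; rewrite -mulr_sumr; apply: ler_piMr.
  by apply: path_weight_ge0 => p x; exact: bitprob_ge0.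
by apply: (@sum_exclusive_le1 _ _ (fun i => good_price (f i) eps)) => i j; exact: excl.
Qed.

End TreeSuccess.

(** * Averaging over the internal randomness and the sample *)

Section HintReduction.
Variable R : realType.
Implicit Types (f g : R -> R).

(** An intersection over all [p] would be uncountable. But goodness depends only on the revenue at
    the output, and the acceptable revenues form an upward closed set, hence an interval. *)
Lemma measurable_good_price f eps :
  measurable_fun setT (qval f) -> measurable [set y | good_price f eps y].
Proof.
move=> mq; have mRev : measurable_fun setT (Rev f).
  by apply: measurable_funM => //; exact: measurable_id.
have up : measurable [set z : R | forall p, (1 - eps) * Rev f p <= z].
  apply: is_interval_measurable => x y /= xP _ z /andP[xz _] p.
  exact: le_trans (xP p) xz.
by have := mRev measurableT _ up; rewrite setTI.
Qed.

Lemma measurable_tree_success d (T : measurableType d) f eps m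
    (price out : T -> seq bool -> R) :
  measurable_fun setT (qval f) ->
  (forall s, measurable_fun setT (price ^~ s)) ->
  (forall s, measurable_fun setT (out ^~ s)) ->
  measurable_fun setT (fun t => tree_success f eps m (price t) (out t)).
Proof.
move=> mq mprice mout; apply: measurable_sum => b.
apply: measurable_funM.
  apply: measurable_prod => i _ /=; case: (tnth b i) => /=.
    exact: measurableT_comp.
  by apply: measurable_funB => //; exact: measurableT_comp.
apply: measurable_fun_ifT => //.
apply: (measurable_fun_bool true).
rewrite setTI.
have -> : (fun x => `[< good_price f eps (out x b) >]) @^-1` [set true] =
          (out ^~ (b : seq bool)) @^-1` [set y | good_price f eps y].
  by apply/seteqP; split => x /= /asboolP.
by rewrite -[X in measurable X]setTI; apply: mout => //; exact: measurable_good_price.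
Qed.

Lemma tree_success_ge0 f eps m price out : (forall p, 0 <= qval f p <= 1) ->
  0 <= tree_success f eps m price out.
Proof.
move=> q01; rewrite tree_successE; apply: sumr_ge0 => b _; apply: mulr_ge0.
  by apply: path_weight_ge0 => p x; exact: bitprob_ge0.
by case: ifP.
Qed.

Lemma sum_success_range_le k (f : 'I_k -> R -> R) eps (B : R)
    d (T : measurableType d) (P : probability T R) m
    (price out : T -> seq bool -> R) :
  (forall i, measurable_fun setT (qval (f i))) ->
  (forall i p, 0 <= qval (f i) p <= 1) ->
  (forall price out, \sum_i tree_success (f i) eps m price out <= B) ->
  (forall s, measurable_fun setT (price ^~ s)) ->
  (forall s, measurable_fun setT (out ^~ s)) ->
  (\sum_i success_range P (f i) eps m price out <= B%:E)%E.
Proof.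
move=> mq q01 sumB mprice mout; rewrite /success_range.
have mT i : measurable_fun setT
    (fun w => (tree_success (f i) eps m (price w) (out w))%:E).
  by apply/measurable_EFinP; exact: measurable_tree_success.
have T0 i w : (0 <= (tree_success (f i) eps m (price w) (out w))%:E)%E.
  by rewrite lee_fin tree_success_ge0.
rewrite -ge0_integral_sum //.
apply: (@le_trans _ _ (\int[P]_w (cst B%:E w))%E).
  apply: ge0_le_integral => //.
  - by move=> w _; apply: sume_ge0.
  - exact: emeasurable_sum.
  - by move=> w _; rewrite sumEFin lee_fin.
by rewrite integral_cst // [X in (_ * X)%E](probability_setT P) mule1.
Qed.

(** For fixed [w] and [v] the algorithm is a deterministic tree, and the success probabilities
    weighted by [f i v] sum to at most [g v * B]. Integrating over [v], the sample costs only a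
    factor equal to the mass of the common majorant [g]. *)
Lemma sum_success_sample_le k (f : 'I_k -> R -> R) g eps (M B : R)
    d (T : measurableType d) (P : probability T R) m
    (price out : T -> R -> seq bool -> R) :
  (forall i, measurable_fun setT (f i)) -> measurable_fun setT g ->
  (forall v, 0 <= g v) -> (forall i v, 0 <= f i v <= g v) ->
  (\int[lebesgue_measure]_v (g v)%:E = M%:E)%E ->
  (forall i, measurable_fun setT (qval (f i))) ->
  (forall i p, 0 <= qval (f i) p <= 1) -> 0 <= B ->
  (forall price out, \sum_i tree_success (f i) eps m price out <= B) ->
  (forall s, measurable_fun setT (fun z : T * R => price z.1 z.2 s)) ->
  (forall s, measurable_fun setT (fun z : T * R => out z.1 z.2 s)) ->
  (\sum_i success_sample P (f i) eps m price out <= (M * B)%:E)%E.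
Proof.
move=> mf mg g0 fg intg mq q01 B0 sumB mprice mout; rewrite /success_sample.
pose F i (z : T * R) : \bar R :=
  (f i z.2 * tree_success (f i) eps m (price z.1 z.2) (out z.1 z.2))%:E.
have mF i : measurable_fun setT (F i).
  apply/measurable_EFinP; apply: measurable_funM.
    exact: measurableT_comp.
  by apply: (@measurable_tree_success _ (T * R)%type (f i) eps m
    (fun z => price z.1 z.2) (fun z => out z.1 z.2)).
have F0 i z : (0 <= F i z)%E.
  rewrite lee_fin mulr_ge0 ?tree_success_ge0 //.
  by have /andP[] := fg i z.2.
(* Tonelli supplies the measurability in [w] of the inner integral. *)
have mI i : measurable_fun setT (fun w => \int[lebesgue_measure]_v F i (w, v))%E.
  exact: (measurable_fun_fubini_tonelli_F (m2 := lebesgue_measure) (F i) (mF i) (F0 i)).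
have mFw i w : measurable_fun setT (fun v => F i (w, v)).
  exact: measurable_fun_pair2.
have I0 i w : setT w -> (0 <= \int[lebesgue_measure]_v F i (w, v))%E.
  by move=> _; apply: integral_ge0 => v _; exact: F0.
rewrite -(ge0_integral_sum P measurableT mI I0).
apply: (@le_trans _ _ (\int[P]_w (cst (M * B)%:E w))%E); last first.
  by rewrite integral_cst // [X in (_ * X)%E](probability_setT P) mule1.
apply: ge0_le_integral => //.
- by move=> w _; apply: sume_ge0 => i _; exact: I0.
- exact: emeasurable_sum.
move=> w _.
rewrite -(ge0_integral_sum lebesgue_measure measurableT (mFw ^~ w)) //.
rewrite /= EFinM muleC -intg -ge0_integralZl //.
apply: ge0_le_integral => //.
- by move=> v _; apply: sume_ge0.
- by apply: emeasurable_sum => i; exact: mFw.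
- by apply/measurable_EFinP; apply: measurable_funM.
- move=> v _; rewrite sumEFin -EFinM lee_fin.
  apply: (@le_trans _ _ (\sum_i g v *
      tree_success (f i) eps m (price w v) (out w v))).
    apply: ler_sum => i _; rewrite ler_wpM2r ?tree_success_ge0 //.
    by have /andP[] := fg i v.
  by rewrite -mulr_sumr mulrC ler_wpM2r.
- exact/measurable_EFinP.
- by move=> v _; rewrite lee_fin.
Qed.

End HintReduction.

(** * Three-step densities and their tails *)

Section StepDensity.
Variable R : realType.
Implicit Types (A B C a b p v x y s : R).

Definition stepf A B C x s v : R :=
  if v < 1 then 0 else if v < x then A else if v < s then B
  else if v < 2 then C else 0.

(** Length of the part of [[a, b[] above [p], in a closed form that linear arithmetic can handle. *)
Definition overlap a b p : R := Num.max 0 (b - Num.max a p).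

Lemma overlap_nincr a b p p' : p <= p' -> overlap a b p' <= overlap a b p.
Proof.
rewrite /overlap => pp'; rewrite ge_max !le_max lexx /=.
by apply/orP; right; case: (leP a p) => ap; case: (leP a p') => ap'; lra.
Qed.

Lemma overlap_before a b p : p <= a -> a <= b -> overlap a b p = b - a.
Proof. by rewrite /overlap; case: (leP a p) => ap; case: (leP 0 (_ - _)) => ?; lra. Qed.

Lemma overlap_inside a b p : a <= p -> p <= b -> overlap a b p = b - p.
Proof. by rewrite /overlap; case: (leP a p) => ap; case: (leP 0 (_ - _)) => ?; lra. Qed.

Lemma overlap_after a b p : a <= b -> b <= p -> overlap a b p = 0.
Proof. by rewrite /overlap; case: (leP a p) => ap; case: (leP 0 (_ - _)) => ?; lra. Qed.

Lemma lebesgue_overlap a b p :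
  lebesgue_measure (`[a, b[ `&` `[p, +oo[ : set R) = (overlap a b p)%:E.
Proof.
rewrite -set_itvI /= lebesgue_measure_itv /=.
rewrite /Order.meet /=.
rewrite joinEtotal lte_fin /overlap; case: (leP 0 (b - _)) => h.
  case: ltP => h' //; congr EFin; lra.
by case: ltP => h' //; exfalso; lra.
Qed.

Lemma stepf_indic A B C x s v : 1 <= x -> x <= s -> s <= 2 ->
  stepf A B C x s v =
  A * \1_(`[1, x[) v + B * \1_(`[x, s[) v + C * \1_(`[s, 2[) v.
Proof.
move=> x1 xs s2; rewrite /stepf !indicE !mem_setE !in_itv /=.
by do ![case: ltP => /= ?]; lra.
Qed.

Lemma measurable_stepf A B C x s : measurable_fun setT (stepf A B C x s).
Proof.
have mlt (c : R) : measurable_fun setT (fun v : R => v < c).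
  by apply: measurable_fun_ltr; [exact: measurable_id|exact: measurable_cst].
do 4! (apply: measurable_fun_ifT; [exact: mlt|exact: measurable_cst|]).
exact: measurable_cst.
Qed.

Lemma stepf_ge0 A B C x s v : 0 <= A -> 0 <= B -> 0 <= C ->
  0 <= stepf A B C x s v.
Proof. by move=> A0 B0 C0; rewrite /stepf; do 4![case: ifP => // _]. Qed.

(** A general [D] serves both the total mass and the tails. *)
Lemma integral_stepf A B C x s (D : set R) : measurable D ->
  0 <= A -> 0 <= B -> 0 <= C -> 1 <= x -> x <= s -> s <= 2 ->
  (\int[lebesgue_measure]_(v in D) (stepf A B C x s v)%:E =
   A%:E * lebesgue_measure (`[1%R, x[ `&` D) + B%:E * lebesgue_measure (`[x, s[ `&` D)
   + C%:E * lebesgue_measure (`[s, 2%R[ `&` D))%E.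
Proof.
move=> mD A0 B0 C0 x1 xs s2.
have mI (c a b : R) : measurable_fun D (fun v : R => (c * \1_(`[a, b[) v)%:E).
  by apply/measurable_EFinP; apply: measurable_funM.
have I0 (c a b : R) v : 0 <= c -> (0 <= (c * \1_(`[a, b[) v)%:E)%E.
  by move=> c0; rewrite lee_fin mulr_ge0.
have intI (c a b : R) : 0 <= c ->
  (\int[lebesgue_measure]_(v in D) (c * \1_(`[a, b[) v)%:E =
   c%:E * lebesgue_measure (`[a, b[ `&` D))%E.
  move=> c0; under eq_integral do rewrite EFinM.
  rewrite ge0_integralZl //=; first by rewrite integral_indic.
  by apply/measurable_EFinP; exact: measurable_indic.
under eq_integral do rewrite (stepf_indic _ _ _ _ x1 xs s2) !EFinD.
rewrite (ge0_integralD lebesgue_measure mD); first last.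
- exact: mI.
- by move=> v _; exact: I0.
- by apply: emeasurable_funD; exact: mI.
- by move=> v _; apply: adde_ge0; exact: I0.
rewrite (ge0_integralD lebesgue_measure mD); first last.
- exact: mI.
- by move=> v _; exact: I0.
- exact: mI.
- by move=> v _; exact: I0.
by rewrite !intI.
Qed.

Lemma total_stepf A B C x s :
  0 <= A -> 0 <= B -> 0 <= C -> 1 <= x -> x <= s -> s <= 2 ->
  (\int[lebesgue_measure]_v (stepf A B C x s v)%:E =
   (A * (x - 1) + B * (s - x) + C * (2 - s))%:E)%E.
Proof.
move=> A0 B0 C0 x1 xs s2; rewrite integral_stepf // !setIT.
have len a b : a <= b -> lebesgue_measure (`[a, b[ : set R) = (b - a)%:E.
  rewrite le_eqVlt lebesgue_measure_itv /= lte_fin => /predU1P[->|->//].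
  by rewrite ltxx subrr.
by rewrite !len // -!EFinM -!EFinD.
Qed.

Lemma qval_stepf A B C x s p :
  0 <= A -> 0 <= B -> 0 <= C -> 1 <= x -> x <= s -> s <= 2 ->
  qval (stepf A B C x s) p =
  A * overlap 1 x p + B * overlap x s p + C * overlap s 2 p.
Proof.
move=> A0 B0 C0 x1 xs s2; rewrite /qval /Rintegral integral_stepf //.
by rewrite !lebesgue_overlap.
Qed.

End StepDensity.

(** * Two-slope densities: tail, hazard rate and near-optimal prices *)

Section TwoSlopeDensity.
Variable R : realType.
Implicit Types A B s x p y z v eps : R.

(* The top step is as high as needed for a total mass of 1. *)
Definition top_step A B s x : R := (1 - A * (x - 1) - B * (s - x)) / (2 - s).

Definition two_slope A B s x : R -> R := stepf A B (top_step A B s x) x s.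

(** The ordering of the three heights makes the density nondecreasing on its support, and [0 < B]
    keeps the tail positive below 2. *)
Definition admissible A B s x : Prop :=
  [/\ 0 <= A, A <= B, 0 < B & [/\ 1 <= x, x <= s, s < 2 & B <= top_step A B s x]].

Lemma top_step_mass A B s x : s < 2 ->
  top_step A B s x * (2 - s) = 1 - A * (x - 1) - B * (s - x).
Proof. by move=> s2; rewrite /top_step divfK // gt_eqF // subr_gt0. Qed.

Lemma qval_two_slope A B s x p : admissible A B s x -> qval (two_slope A B s x) p =
  A * overlap 1 x p + B * overlap x s p + top_step A B s x * overlap s 2 p.
Proof. by case=> A0 AB B0 [x1 xs s2 Btop]; apply: qval_stepf => //; lra. Qed.

Lemma qval_below A B s x p : admissible A B s x -> p <= 1 ->
  qval (two_slope A B s x) p = 1.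
Proof.
move=> adm p1; rewrite qval_two_slope //; case: adm => A0 AB B0 [x1 xs s2 Btop].
rewrite !overlap_before //; try lra.
by rewrite top_step_mass //; lra.
Qed.

Lemma qval_low A B s x p : admissible A B s x -> 1 <= p -> p <= x ->
  qval (two_slope A B s x) p = 1 - A * (p - 1).
Proof.
move=> adm p1 px; rewrite qval_two_slope //; case: adm => A0 AB B0 [x1 xs s2 Btop].
rewrite overlap_inside // !overlap_before //; try lra.
by rewrite top_step_mass //; lra.
Qed.

Lemma qval_mid A B s x p : admissible A B s x -> x <= p -> p <= s ->
  qval (two_slope A B s x) p = 1 - A * (x - 1) - B * (p - x).
Proof.
move=> adm xp ps; rewrite qval_two_slope //; case: adm => A0 AB B0 [x1 xs s2 Btop].
rewrite overlap_after // overlap_inside // overlap_before //; try lra.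
by rewrite top_step_mass //; lra.
Qed.

Lemma qval_top A B s x p : admissible A B s x -> s <= p -> p <= 2 ->
  qval (two_slope A B s x) p = top_step A B s x * (2 - p).
Proof.
move=> adm sp p2; rewrite qval_two_slope //; case: adm => A0 AB B0 [x1 xs s2 Btop].
by rewrite overlap_after // ?(overlap_after xs) // ?overlap_inside //; lra.
Qed.

Lemma qval_above A B s x p : admissible A B s x -> 2 <= p ->
  qval (two_slope A B s x) p = 0.
Proof.
move=> adm p2; rewrite qval_two_slope //; case: adm => A0 AB B0 [x1 xs s2 Btop].
by rewrite !overlap_after //; lra.
Qed.

Lemma qval_nincr A B s x p y : admissible A B s x -> p <= y ->
  qval (two_slope A B s x) y <= qval (two_slope A B s x) p.
Proof.
move=> adm py; rewrite !qval_two_slope //; case: adm => A0 AB B0 [x1 xs s2 Btop].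
by rewrite !lerD // ler_wpM2l ?overlap_nincr //; lra.
Qed.

Lemma qval_bounds A B s x p : admissible A B s x ->
  0 <= qval (two_slope A B s x) p <= 1.
Proof.
move=> adm; apply/andP; split.
  have [p2|p2] := leP 2 p; first by rewrite qval_above.
  by rewrite -(qval_above adm (lexx 2)) qval_nincr // ltW.
have [p1|p1] := leP p 1; first by rewrite qval_below.
by rewrite -(qval_below adm (lexx 1)) qval_nincr // ltW.
Qed.

Lemma measurable_qval A B s x : admissible A B s x ->
  measurable_fun setT (qval (two_slope A B s x)).
Proof.
by move=> adm; apply: nonincreasing_measurable => // p y; exact: qval_nincr.
Qed.

Lemma two_slope_density A B s x : admissible A B s x ->
  density_on_1_2 (two_slope A B s x).
Proof.
case=> A0 AB B0 [x1 xs s2 Btop]; split.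
- exact: measurable_stepf.
- by move=> v; apply: stepf_ge0; lra.
- move=> v; rewrite in_itv /= negb_and -!ltNge /two_slope /stepf => /orP[->//|v2].
  by rewrite !ifF //; apply/negbTE; rewrite -leNgt; lra.
- by rewrite total_stepf ?top_step_mass //; [congr EFin|..]; lra.
Qed.

(* The density is nondecreasing on its support, hence so is the hazard rate. *)
Lemma two_slope_MHR A B s x : admissible A B s x -> MHR (two_slope A B s x).
Proof.
move=> adm y z yz qz.
have z2 : z < 2 by case: (ltP z 2) qz => // z2; rewrite qval_above // ltxx.
case: (adm) => A0 AB B0 [x1 xs s2 Btop]; apply: ler_pM.
- by apply: stepf_ge0; lra.
- by rewrite invr_ge0; have /andP[] := qval_bounds y adm.
- rewrite /two_slope /stepf z2 (le_lt_trans yz z2).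
  by case: (ltP y 1) => ?; case: (ltP y x) => ?; case: (ltP y s) => ?;
    case: (ltP z 1) => ?; case: (ltP z x) => ?; case: (ltP z s) => ? /=; lra.
- by rewrite lef_pV2 ?qval_nincr // posrE // (lt_le_trans qz) // qval_nincr.
Qed.

(** Only the kink [x] is used as competitor. The right side extends the two slopes of the tail to
    all prices: below 1 the extension is at least 1, and between [s] and 2 it dominates the tail
    because the top step is at least [B]. Elsewhere the revenue is not positive, so the price is not
    good. *)
Lemma good_two_slope A B s x eps y : admissible A B s x -> eps < 1 ->
  good_price (two_slope A B s x) eps y ->
  (1 - eps) * (x * (1 - A * (x - 1))) <=
    (if y <= x then y * (1 - A * (y - 1))
     else y * (1 - A * (x - 1) - B * (y - x))).
Proof.
move=> adm e1 /(_ x); case: (adm) => A0 AB B0 [x1 xs s2 Btop].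
rewrite /Rev (qval_low adm x1 (lexx x)).
have mass := @top_step_mass A B s x s2.
have qx : 0 < 1 - A * (x - 1) by nra.
have : 0 < (1 - eps) * (x * (1 - A * (x - 1))).
  by rewrite !mulr_gt0 ?subr_gt0 //; lra.
move: ((1 - eps) * _) => r r0 H; have yq := lt_le_trans r0 H.
have [y0|y0] := leP y 0.
  have /andP[q0 _] := qval_bounds y adm.
  by have := mulr_le0_ge0 y0 q0; lra.
apply: (le_trans H); have [yx|xy] := leP y x; rewrite ler_wpM2l ?(ltW y0) //.
  have [y1|y1] := leP y 1; last by rewrite qval_low // ltW.
  by rewrite qval_below //; nra.
have [ys|sy] := leP y s; first by rewrite qval_mid // ltW.
have [y2|y2] := leP y 2; last by move: yq; rewrite qval_above ?mulr0 ?ltxx // ltW.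
by rewrite (qval_top adm (ltW sy) y2); nra.
Qed.

End TwoSlopeDensity.

(** * Families of kinks: envelope and perturbation of the tail *)

Section Family.
Variable R : realType.
Implicit Types (A B s d w eps : R).

Definition step_point (x0 d : R) (i : 'I_15) : R := x0 + i%:R * d.

Lemma step_point_bounds (x0 d : R) (i : 'I_15) : 0 <= d ->
  x0 <= step_point x0 d i <= x0 + 14 * d.
Proof.
move=> d0; rewrite /step_point lerDl lerD2l mulr_ge0 //= ler_wpM2r //.
by rewrite ler_nat -ltnS.
Qed.

Lemma step_point_gap (x0 d : R) (i j : 'I_15) : 0 <= d -> (i < j)%N ->
  step_point x0 d i + d <= step_point x0 d j.
Proof.
move=> d0 ij; rewrite /step_point -addrA lerD2l -[X in _ + X]mul1r -mulrDl natr1.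
by rewrite ler_wpM2r // ler_nat.
Qed.

Lemma top_step_ndecr A B s x y : A <= B -> s < 2 -> x <= y ->
  top_step A B s x <= top_step A B s y.
Proof.
move=> AB s2 xy; rewrite /top_step ler_pM2r ?invr_gt0 ?subr_gt0 //; nra.
Qed.

(** Moving the kink to the right frees mass for the top step, so the leftmost kink is the critical
    one. *)
Lemma admissible_step_point A B s x0 d i : admissible A B s x0 -> 0 <= d ->
  x0 + 14 * d <= s -> admissible A B s (step_point x0 d i).
Proof.
case=> A0 AB B0 [x1 xs s2 Btop] d0 x14.
have /andP[lo hi] := step_point_bounds x0 i d0.
split => //; split; [lra|lra|by []|].
by apply: (le_trans Btop); exact: top_step_ndecr.
Qed.

(** The pointwise maximum of the 15 densities: the first one is largest before [s], the last one
    after it. *)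
Definition envelope A B s x0 d : R -> R :=
  stepf A B (top_step A B s (x0 + 14 * d)) x0 s.

Lemma two_slope_le_envelope A B s x0 d i v : admissible A B s x0 -> 0 <= d ->
  x0 + 14 * d <= s ->
  0 <= two_slope A B s (step_point x0 d i) v <= envelope A B s x0 d v.
Proof.
move=> adm d0 x14; have [_ f0 _ _] := two_slope_density (admissible_step_point i adm d0 x14).
rewrite f0 /=; case: adm => A0 AB B0 [x1 xs s2 Btop].
have /andP[lo hi] := step_point_bounds x0 i d0.
have top := top_step_ndecr AB s2 hi.
rewrite /two_slope /envelope /stepf; move: (step_point x0 d i) lo hi top => y lo hi top.
case: (ltP v 1) => // v1; case: (ltP v x0) => vx0.
  by rewrite (lt_le_trans vx0).
by case: (ltP v y) => vy; case: (ltP v s) => vs; case: (ltP v 2) => ? //; lra.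
Qed.

(** The envelope exceeds the density with the last kink only between the extreme kinks, and there by
    [B - A]. *)
Lemma integral_envelope A B s x0 d : admissible A B s x0 -> 0 <= d ->
  x0 + 14 * d <= s ->
  (\int[lebesgue_measure]_v (envelope A B s x0 d v)%:E =
   (1 + (B - A) * (14 * d))%:E)%E.
Proof.
case=> A0 AB B0 [x1 xs s2 Btop] d0 x14.
have top := @top_step_ndecr A B s x0 (x0 + 14 * d) AB s2 ltac:(lra).
rewrite total_stepf ?top_step_mass //; [congr EFin|..]; lra.
Qed.

Lemma sum_two_fifteenths (F : 'I_15 -> \bar R) (r : R) :
  (\sum_i F i <= r%:E)%E -> r < 2 -> ~ (forall i, ((2 / 15)%:E <= F i)%E).
Proof.
move=> Fr r2 H; have := le_trans (lee_sum _ (fun i (_ : true) => H i)) Fr.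
rewrite sumEFin lee_fin sumr_const card_ord => h.
have : (2 / 15 : R) *+ 15 = 2 by field.
lra.
Qed.

(** Between [x0] and [s] the reference tail is at least [be], its complement at least [al], and the
    perturbation at most [(B - A) * (x - x0)]. Outside [[x0, 2]] the two tails agree. *)
Lemma qval_sqdiff A B s x0 x al be p :
  admissible A B s x0 -> admissible A B s x -> x0 <= x ->
  0 <= al -> al <= A * (x0 - 1) -> 0 <= be -> be <= 1 - A * (x0 - 1) - B * (s - x0) ->
  (qval (two_slope A B s x) p - qval (two_slope A B s x0) p) ^+ 2 * (al * be) <=
  ((B - A) * (x - x0)) ^+ 2 *
    (qval (two_slope A B s x0) p * (1 - qval (two_slope A B s x0) p)).
Proof.
move=> adm0 adm x0x al0 alA be0 beB.
case: (adm0) => A0 AB B0 [x01 x0s s2 Btop0].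
case: (adm) => _ _ _ [x1 xs _ Btop].
have /andP[q0 q1] := qval_bounds p adm0.
have D0 : 0 <= (B - A) * (x - x0) by apply: mulr_ge0; lra.
have conclude q r D : 0 <= q - r -> q - r <= D -> be <= r -> al <= 1 - r ->
  (q - r) ^+ 2 * (al * be) <= D ^+ 2 * (r * (1 - r)).
  move=> qr0 qrD ber alr; apply: ler_pM.
  - exact: sqr_ge0.
  - exact: mulr_ge0.
  - by rewrite lerXn2r // nnegrE //; lra.
  - by rewrite [al * be]mulrC; apply: ler_pM.
have [px0|x0p] := leP p x0.
  have -> : qval (two_slope A B s x) p = qval (two_slope A B s x0) p.
    have [p1|p1] := leP p 1; first by rewrite !qval_below.
    by rewrite !qval_low //; lra.
  by rewrite subrr expr0n mul0r; apply: mulr_ge0; [exact: sqr_ge0|apply: mulr_ge0; lra].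
have [ps|sp] := leP p s.
  have r0 : qval (two_slope A B s x0) p = 1 - A * (x0 - 1) - B * (p - x0).
    by rewrite qval_mid // ltW.
  have [px|xp] := leP p x.
    have r1 : qval (two_slope A B s x) p = 1 - A * (p - 1).
      by rewrite qval_low //; lra.
    by apply: conclude; rewrite r0 ?r1; nra.
  have r1 : qval (two_slope A B s x) p = 1 - A * (x - 1) - B * (p - x).
    by rewrite qval_mid // ltW.
  by apply: conclude; rewrite r0 ?r1; nra.
have [p2|p2] := leP p 2; last first.
  rewrite (qval_above adm0 (ltW p2)) (qval_above adm (ltW p2)).
  by rewrite subrr expr0n /= !mul0r mulr0.
(* Past [s] both tails are their values at [s] scaled by [t]: the squared difference gains [t ^+ 2],
   while the variance loses at most a factor [t]. *)
have [t [t0 t1 tE]] : exists t, [/\ 0 <= t, t <= 1 & 2 - p = t * (2 - s)].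
  exists ((2 - p) / (2 - s)); split.
  - by apply: divr_ge0; lra.
  - by rewrite ler_pdivrMr; lra.
  - by rewrite divfK // gt_eqF // subr_gt0.
have r0 : qval (two_slope A B s x0) p = t * (1 - A * (x0 - 1) - B * (s - x0)).
  by rewrite (qval_top adm0 (ltW sp) p2) tE mulrCA top_step_mass.
have r1 : qval (two_slope A B s x) p = t * (1 - A * (x - 1) - B * (s - x)).
  by rewrite (qval_top adm (ltW sp) p2) tE mulrCA top_step_mass.
have rle : qval (two_slope A B s x0) p <= 1 - A * (x0 - 1) - B * (s - x0).
  rewrite r0; apply: ler_piMl => //; lra.
rewrite r1 {1 2}r0 -mulrBr.
have -> : 1 - A * (x - 1) - B * (s - x) - (1 - A * (x0 - 1) - B * (s - x0))
  = (B - A) * (x - x0) by ring.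
rewrite exprMn -mulrA [t ^+ 2 * _]mulrCA; apply: ler_wpM2l; first exact: sqr_ge0.
apply: (@le_trans _ _ (t * (be * al))).
  rewrite [be * al]mulrC ler_wpM2r ?mulr_ge0 // expr2; exact: ler_piMl.
by rewrite -mulrA ler_wpM2l // ler_pM //; nra.
Qed.

(** The induction closes since (1 + 2t)(1 + V) <= 1 + 2t + 2V as soon as 2t <= 1. *)
Lemma expr_one_plus_le (V : R) m : 0 <= V -> m%:R * V <= 1 / 2 ->
  (1 + V) ^+ m <= 1 + 2 * (m%:R * V).
Proof.
move=> V0; elim: m => [|m IHm]; first by rewrite expr0 mul0r mulr0 addr0.
rewrite -natr1 exprSr mulrDl mul1r => mV.
have m0 : 0 <= m%:R :> R by [].
have mV0 : 0 <= m%:R * V by exact: mulr_ge0.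
have := IHm ltac:(lra); move: (m%:R * V) mV mV0 => t tV t0 IH.
apply: le_trans (ler_wpM2r _ IH) _; first lra.
nra.
Qed.

End Family.

(** * Separation of near-optimal prices and the two regimes of [eps] *)

Section HardFamilies.
Variable R : realType.
Implicit Types (A B s d w eps : R).

Definition hard_density A B s (x0 d : R) (i : 'I_15) : R -> R :=
  two_slope A B s (step_point x0 d i).

(* The factor [1 + (B - A) * (14 * d)] is the mass of [envelope A B s x0 d]. *)
Definition resists eps m A B s (x0 d : R) : Prop := exists Bd : R,
  [/\ 0 <= Bd, (1 + (B - A) * (14 * d)) * Bd < 2 &
   forall price out,
     \sum_i tree_success (hard_density A B s x0 d i) eps m price out <= Bd].

Lemma resists_sample A B s x0 d eps m (dT : measure_display)
    (T : measurableType dT) (P : probability T R)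
    (price out : T -> R -> seq bool -> R) :
  admissible A B s x0 -> 0 <= d -> x0 + 14 * d <= s -> resists eps m A B s x0 d ->
  (forall u, measurable_fun setT (fun z : T * R => price z.1 z.2 u)) ->
  (forall u, measurable_fun setT (fun z : T * R => out z.1 z.2 u)) ->
  ~ (forall i, ((2 / 15)%:E <=
       success_sample P (hard_density A B s x0 d i) eps m price out)%E).
Proof.
move=> adm d0 x14 [Bd [Bd0 MBd sumB]] mprice mout.
have adm_i i := admissible_step_point i adm d0 x14.
apply: sum_two_fifteenths MBd.
apply: (@sum_success_sample_le R 15 (hard_density A B s x0 d) (envelope A B s x0 d)) => //.
- by move=> i; have [] := two_slope_density (adm_i i).
- exact: measurable_stepf.
- move=> v; have /andP[f0 fg] := two_slope_le_envelope ord0 v adm d0 x14.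
  exact: le_trans fg.
- by move=> i v; exact: two_slope_le_envelope.
- exact: integral_envelope.
- by move=> i; exact: measurable_qval.
- by move=> i p; exact: qval_bounds.
Qed.

Lemma resists_range A B s x0 d eps m (dT : measure_display)
    (T : measurableType dT) (P : probability T R) (price out : T -> seq bool -> R) :
  admissible A B s x0 -> 0 <= d -> x0 + 14 * d <= s -> resists eps m A B s x0 d ->
  (forall u, measurable_fun setT (fun w : T => price w u)) ->
  (forall u, measurable_fun setT (fun w : T => out w u)) ->
  ~ (forall i, ((2 / 15)%:E <=
       success_range P (hard_density A B s x0 d i) eps m price out)%E).
Proof.
move=> adm d0 x14 [Bd [Bd0 MBd sumB]] mprice mout.
have adm_i i := admissible_step_point i adm d0 x14.
(* The envelope has mass at least 1, so the bound made for the sample covers this hint too. *)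
have Bd2 : Bd < 2.
  apply: le_lt_trans MBd; apply: ler_peMl => //.
  by case: adm => A0 AB _ _; rewrite lerDl !mulr_ge0 //; lra.
apply: sum_two_fifteenths Bd2.
apply: (@sum_success_range_le R 15 (hard_density A B s x0 d)) => //.
- by move=> i; exact: measurable_qval.
- by move=> i p; exact: qval_bounds.
Qed.

(** The threshold [z] separates the good sets: prices up to [z] are too low for the kink [xj],
    prices beyond it too high for [xi]. *)
Lemma hard_density_not_common A B s x0 d eps (i j : 'I_15) y z :
  admissible A B s x0 -> 0 <= d -> x0 + 14 * d <= s -> eps < 1 ->
  let xi := step_point x0 d i in let xj := step_point x0 d j in
  xi <= z -> z <= xj ->
  (y <= z -> y * (1 - A * (y - 1)) < (1 - eps) * (xj * (1 - A * (xj - 1)))) ->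
  (z < y -> y * (1 - A * (xi - 1) - B * (y - xi)) <
    (1 - eps) * (xi * (1 - A * (xi - 1)))) ->
  ~ (good_price (hard_density A B s x0 d i) eps y /\
     good_price (hard_density A B s x0 d j) eps y).
Proof.
move=> adm d0 x14 e1 xi xj iz zj notj noti [].
have adm_i k := admissible_step_point k adm d0 x14.
have [yz|zy] := leP y z.
  move=> _ /(good_two_slope (adm_i j) e1); rewrite (le_trans yz zj) => H.
  by have := le_lt_trans H (notj yz); rewrite ltxx.
move=> /(good_two_slope (adm_i i) e1).
rewrite [y <= _]leNgt (le_lt_trans iz zy) /= => H.
by have := le_lt_trans H (noti zy); rewrite ltxx.
Qed.

Lemma tree_success0 (f : R -> R) eps price out : tree_success f eps 0 price out =
  if `[< good_price f eps (out [::]) >] then 1 else 0.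
Proof.
rewrite /tree_success (big_pred1 [tuple]) => [|b].
  by rewrite big_ord0 mul1r.
by apply/esym/eqP; exact: tuple0.
Qed.

(** With [B = 4 / 3] the first density is uniform on [[5/4, 2[], so its top step equals [B]; the
    last kink is [s] itself. *)
Lemma coarse_family_admissible : admissible 0 (4 / 3) (39 / 20) (5 / 4 : R).
Proof.
split; [lra|lra|lra|split; [lra|lra|lra|]].
by rewrite /top_step ler_pdivlMr; lra.
Qed.

Lemma coarse_family_resists eps : 0 < eps -> eps < 64^-1 ->
  resists eps 0 0 (4 / 3) (39 / 20) (5 / 4) (1 / 20).
Proof.
move=> e0 e64; exists 1; split; [lra|lra|move=> price out].
under eq_bigr do rewrite tree_success0.
apply: (@sum_exclusive_le1 _ _ _ (fun i => good_price (hard_density _ _ _ _ _ i) eps)).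
move=> i j ij; set y := out _; move: y => y.
have d0 : 0 <= 1 / 20 :> R by lra.
have gap := @step_point_gap R (5 / 4) (1 / 20) i j d0 ij.
have /andP[ilo _] := @step_point_bounds R (5 / 4) (1 / 20) i d0.
have /andP[_ jhi] := @step_point_bounds R (5 / 4) (1 / 20) j d0.
(* Since [A = 0], a price up to 63/64 of the kink of [j] earns at most itself, which is too little
   as [eps < 64^-1]. *)
apply: (@hard_density_not_common _ _ _ _ _ _ _ _ _ (63 / 64 * step_point (5 / 4) (1 / 20) j)
  coarse_family_admissible) => //; try lra.
- move=> yz; nra.
- move: (step_point _ _ i) (step_point _ _ j) gap ilo jhi => x x' gap xlo xhi yz.
  (* With u = y - x the revenue is x - u (4x/3 - 1) - 4u^2/3, decreasing in u, so the least u
     decides. The resulting condition is concave in x on [5/4, 19/10]. *)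
  have uE : 63 / 1280 - x / 64 <= y - x by lra.
  have : 0 <= (x - 5 / 4) * (19 / 10 - x) by apply: mulr_ge0; lra.
  have : 0 <= (4 / 3 * x - 1) * (y - x - (63 / 1280 - x / 64)).
    by apply: mulr_ge0; lra.
  have : 0 <= (y - x - (63 / 1280 - x / 64)) * (y - x + (63 / 1280 - x / 64)).
    by apply: mulr_ge0; lra.
  have : 0 < (64^-1 - eps) * x by apply: mulr_gt0; lra.
  nra.
Qed.

Lemma fine_family_admissible w : 0 < w -> w < 1 / 24 ->
  admissible (2 / 3) (2 / 3 + 4 * w) (39 / 20) (5 / 4 - 2 * w).
Proof.
move=> w0 w1; split; [lra|lra|lra|split; [lra|lra|lra|]].
by rewrite /top_step ler_pdivlMr; nra.
Qed.

(** Kinks lie between w and 2w below 5/4, where the revenue of slope [A] has derivative between 4w/3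
    and 8w/3. The extra slope lowers it by 4wx >= 4w at a kink x, so revenue then falls at rate at
    least 4w/3. Half a spacing, w/30, thus costs 2w^2/45 = 8 eps/5, more than [eps] times the
    maximal revenue 25/24 of slope [A]. *)
Lemma fine_family_not_common w eps (i j : 'I_15) y : 0 < w -> w < 1 / 24 ->
  w ^+ 2 = 36 * eps -> (i < j)%N ->
  ~ (good_price (hard_density (2 / 3) (2 / 3 + 4 * w) (39 / 20)
       (5 / 4 - 2 * w) (w / 15) i) eps y /\
     good_price (hard_density (2 / 3) (2 / 3 + 4 * w) (39 / 20)
       (5 / 4 - 2 * w) (w / 15) j) eps y).
Proof.
move=> w0 w1 we ij.
have d0 : 0 <= w / 15 by lra.
have gap := @step_point_gap R (5 / 4 - 2 * w) (w / 15) i j d0 ij.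
have /andP[ilo _] := @step_point_bounds R (5 / 4 - 2 * w) (w / 15) i d0.
have /andP[_ jhi] := @step_point_bounds R (5 / 4 - 2 * w) (w / 15) j d0.
have e1 : eps < 1 by nra.
apply: (@hard_density_not_common _ _ _ _ _ _ _ _ _
  (step_point (5 / 4 - 2 * w) (w / 15) j - w / 30)
  (fine_family_admissible w0 w1)) => //; try lra.
- have jlo : 1 <= step_point (5 / 4 - 2 * w) (w / 15) j by lra.
  move: (step_point _ _ j) jlo jhi => x xlo xhi yz.
  have slope : w / 30 * (4 / 3 * w) <= (x - y) * (5 / 3 - 2 / 3 * (x + y)).
    by apply: ler_pM; lra.
  (* The revenue at the kink is 25/24 - (2/3)(x - 5/4)^2. *)
  have : 0 <= eps * (x - 5 / 4) ^+ 2 by rewrite mulr_ge0 ?sqr_ge0; nra.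
  nra.
- move: (step_point _ _ i) (step_point _ _ j) gap ilo jhi => x x' gap xlo x'hi yz.
  have slope : w / 30 * (4 / 3 * w) <=
      (y - x) * (y * (2 / 3 + 4 * w) - (5 / 3 - 2 / 3 * x)).
    by apply: ler_pM; nra.
  have : 0 <= eps * (x - 5 / 4) ^+ 2 by rewrite mulr_ge0 ?sqr_ge0; nra.
  nra.
Qed.

Lemma fine_family_resists w eps m : 0 < w -> w < 1 / 24 ->
  w ^+ 2 = 36 * eps -> m%:R * eps ^+ 2 < (200^-1) ^+ 4 ->
  resists eps m (2 / 3) (2 / 3 + 4 * w) (39 / 20) (5 / 4 - 2 * w) (w / 15).
Proof.
move=> w0 w1 we me.
have d0 : 0 <= w / 15 by lra.
have x14 : 5 / 4 - 2 * w + 14 * (w / 15) <= 39 / 20 by lra.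
have adm0 := fine_family_admissible w0 w1.
have adm i := admissible_step_point i adm0 d0 x14.
(* 720 = 16 * 45: the squared perturbation is at most (4 w^2)^2, and the reference variance bounds
   used below are 1/9 and 1/5. *)
pose V := 720 * (w ^+ 2) ^+ 2.
have V0 : 0 <= V by rewrite /V; have := sqr_ge0 (w ^+ 2); lra.
have mV : m%:R * V <= 1 / 1000.
  have -> : m%:R * V = 720 * 36 ^+ 2 * (m%:R * eps ^+ 2) by rewrite /V we; ring.
  lra.
have chi2 : (1 + V) ^+ m <= 1 + 1 / 500.
  by apply: le_trans (expr_one_plus_le V0 _) _; lra.
(* Here [eta] is 1/40, so this is at most 1 + 15 (1/40 + 1/50) = 67/40, while the envelope mass is
   below 1.01. *)
exists (1 + 15%:R * (40^-1 + ((1 + V) ^+ m - 1) / (4 * 40^-1))).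
have chi0 : 1 <= (1 + V) ^+ m by apply: exprn_ege1; lra.
split.
- lra.
- nra.
move=> price out.
apply: (@tree_success_sum_le _ _ _ _ _
  (two_slope (2 / 3) (2 / 3 + 4 * w) (39 / 20) (5 / 4 - 2 * w))) => //.
- by move=> p; exact: qval_bounds.
- by move=> i p; exact: qval_bounds.
- move=> i p; have /andP[lo hi] := step_point_bounds (5 / 4 - 2 * w) i d0.
  have := @qval_sqdiff _ _ _ _ _ _ (1 / 9) (1 / 5) p adm0 (adm i) lo
    ltac:(lra) ltac:(nra) ltac:(lra) ltac:(nra).
  have /andP[q0 q1] := qval_bounds p adm0.
  rewrite -/(hard_density _ _ _ _ _ i).
  have D : ((2 / 3 + 4 * w - 2 / 3) *
     (step_point (5 / 4 - 2 * w) (w / 15) i - (5 / 4 - 2 * w))) ^+ 2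
       <= 16 * (w ^+ 2) ^+ 2.
    have -> : 16 * (w ^+ 2) ^+ 2 = (4 * w * w) ^+ 2 by ring.
    rewrite lerXn2r // ?nnegrE; [apply: mulr_ge0; lra|nra|].
    by apply: ler_pM; lra.
  have q2 : 0 <= qval (two_slope (2 / 3) (2 / 3 + 4 * w) (39 / 20) (5 / 4 - 2 * w)) p
    * (1 - qval (two_slope (2 / 3) (2 / 3 + 4 * w) (39 / 20) (5 / 4 - 2 * w)) p).
    by apply: mulr_ge0; lra.
  have := ler_wpM2r q2 D; rewrite /V; lra.
- by move=> i j y; exact: fine_family_not_common.
Qed.

Lemma hard_family eps : 0 < eps -> eps < 64^-1 ->
  exists A B s x0 d : R, [/\ admissible A B s x0, 0 <= d, x0 + 14 * d <= s &
    forall m, m%:R < (200^-1) ^+ 4 / eps ^+ 2 -> resists eps m A B s x0 d].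
Proof.
move=> e0 e64; have e2 : 0 < eps ^+ 2 by rewrite exprn_gt0.
(* 144 = 6 * 24, so the small case is exactly [w < 1 / 24]. *)
have [small|large] := ltP eps ((144^-1) ^+ 2).
  pose w := 6 * Num.sqrt eps.
  have w0 : 0 < w by rewrite mulr_gt0 // sqrtr_gt0.
  have we : w ^+ 2 = 36 * eps by rewrite exprMn sqr_sqrtr ?(ltW e0) //; ring.
  have w1 : w < 1 / 24 by nra.
  exists (2 / 3), (2 / 3 + 4 * w), (39 / 20), (5 / 4 - 2 * w), (w / 15).
  split; [exact: fine_family_admissible|lra|lra|].
  by move=> m; rewrite ltr_pdivlMr //; exact: fine_family_resists.
exists 0, (4 / 3), (39 / 20), (5 / 4), (1 / 20).
split; [exact: coarse_family_admissible|lra|lra|].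
move=> m; rewrite ltr_pdivlMr // => me.
(* Here [eps ^+ 2] is at least 144^-4 > 200^-4, so the query bound leaves only [m = 0]. *)
have [->|m0] := posnP m; first exact: coarse_family_resists.
have m1 : 1 <= m%:R :> R by rewrite (ler_nat _ 1).
exfalso; have : (144^-1) ^+ 4 <= eps ^+ 2.
  by rewrite (exprM _ 2 2 : _ ^+ 4 = _) lerXn2r // nnegrE ?exprn_ge0 ?ltW.
have : eps ^+ 2 <= m%:R * eps ^+ 2 by rewrite ler_peMl // ltW.
lra.
Qed.

End HardFamilies.

Unset Implicit Arguments.

Theorem theorem5p3 (R : realType) :
  exists c : R, 0 < c /\
  forall eps : R, 0 < eps -> eps < 64^-1 ->
  exists Fam : set (R -> R),
    (forall f, Fam f -> density_on_1_2 f /\ MHR f) /\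
    (* one-sample hint *)
    (forall (d : measure_display) (T : measurableType d) (P : probability T R)
            (m : nat) (price out : T -> R -> seq bool -> R),
       (forall s, measurable_fun setT (fun z : T * R => price z.1 z.2 s)) ->
       (forall s, measurable_fun setT (fun z : T * R => out z.1 z.2 s)) ->
       (forall f, Fam f -> ((2 / 15)%:E <= success_sample P f eps m price out)%E) ->
       c / eps ^+ 2 <= m%:R) /\
    (* value-range hint *)
    (forall (d : measure_display) (T : measurableType d) (P : probability T R)
            (m : nat) (price out : T -> seq bool -> R),
       (forall s, measurable_fun setT (fun w : T => price w s)) ->
       (forall s, measurable_fun setT (fun w : T => out w s)) ->
       (forall f, Fam f -> ((2 / 15)%:E <= success_range P f eps m price out)%E) ->
       c / eps ^+ 2 <= m%:R).
Proof.
(* Small enough for both regimes: 720 * 36^2 * c <= 1/1000 and c < 144^-4. *)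
exists ((200^-1) ^+ 4); split; first by rewrite exprn_gt0.
move=> eps e0 e64; have [A [B [s [x0 [d [adm d0 x14 hard]]]]]] := hard_family e0 e64.
have adm_i i := admissible_step_point i adm d0 x14.
exists [set f | exists i, f = hard_density A B s x0 d i]; split; [|split].
- move=> _ [i ->]; split; [exact: two_slope_density|exact: two_slope_MHR].
- move=> dT T P m price out mprice mout H; rewrite leNgt; apply/negP => /hard res.
  apply: (resists_sample (P := P) adm d0 x14 res mprice mout) => i.
  by apply: H; exists i.
- move=> dT T P m price out mprice mout H; rewrite leNgt; apply/negP => /hard res.
  apply: (resists_range (P := P) adm d0 x14 res mprice mout) => i.
  by apply: H; exists i.
Qed.
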